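(* Let $\Omega$ be a finite set, let $k,l \geq 2$ be multiplicatively independent integers, and let $f \colon \mathbb{N}_0 \to \Omega$ be a sequence. Suppose that $f$ is $k$-automatic and asymptotically $l$-automatic. Then $f$ is asymptotically equal to a periodic sequence, i.e. there exists a periodic sequence $\tilde f\colon\mathbb{N}_0\to\Omega$ with $f(n)=\tilde f(n)$ for almost all $n\in\mathbb{N}_0$.
   Context: $\mathbb{N}_0 = \{0,1,2,\dots\}$. Integers $k,l\geq 2$ are multiplicatively independent if $\log k/\log l \notin \mathbb{Q}$. For $A \subset \mathbb{N}_0$, the upper density is $\bar d(A) = \limsup_{N\to\infty} |A\cap\{0,\dots,N-1\}|/N$; a property holds for almost all $n\in\mathbb{N}_0$ if the set of $n$ where it fails has upper density $0$. Two sequences $f,g\colon \mathbb{N}_0\to\Omega$ are asymptotically equal, written $f\simeq g$, if $f(n)=g(n)$ for almost all $n$. The $k$-kernel of $f$ is $\mathcal{N}_k(f) = \{ n \mapsto f(k^\alpha n + r) : \alpha, r \in \mathbb{N}_0,\ r < k^\alpha\}$. The sequence $f$ is $k$-automatic if $\mathcal{N}_k(f)$ is finite, and asymptotically $l$-automatic if the set of equivalence classes $\mathcal{N}_l(f)/{\simeq}$ is finite. *)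

(* Defs.v *)
From Stdlib Require Import Reals List.
From Coquelicot Require Import Coquelicot.
From mathcomp Require Import ssreflect ssrfun ssrbool eqtype ssrnat seq fintype.

Set Implicit Arguments.
Unset Strict Implicit.

Definition mult_indep (k l : nat) : Prop :=
  ~ exists (p q : Z), q <> 0%Z /\
      (ln (INR k) / ln (INR l))%R = (IZR p / IZR q)%R.

Definition count_below (A : nat -> bool) (N : nat) : nat :=
  count A (iota 0 N).

Definition upper_density (A : nat -> bool) : Rbar :=
  LimSup_seq (fun N => (INR (count_below A N) / INR N)%R).

Definition asym_eq (Omega : finType) (f g : nat -> Omega) : Prop :=
  upper_density (fun n => f n != g n) = Rbar.Finite 0%R.

Definition kernel (Omega : Type) (k : nat) (f : nat -> Omega) :
    (nat -> Omega) -> Prop :=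
  fun g => exists a r : nat, (r < k ^ a)%nat /\ g = (fun n => f (k ^ a * n + r)%nat).

Definition finite_set (T : Type) (P : T -> Prop) : Prop :=
  exists s : list T, forall x, P x -> List.In x s.

Definition automatic (Omega : Type) (k : nat) (f : nat -> Omega) : Prop :=
  finite_set (kernel k f).

Definition kernel_classes (Omega : finType) (l : nat) (f : nat -> Omega) :
    ((nat -> Omega) -> Prop) -> Prop :=
  fun C => exists g, kernel l f g /\ C = (fun h => asym_eq g h).

Definition asym_automatic (Omega : finType) (l : nat) (f : nat -> Omega) : Prop :=
  finite_set (kernel_classes l f).

Definition periodic (Omega : Type) (g : nat -> Omega) : Prop :=
  exists p : nat, (0 < p)%nat /\ forall n, g (n + p)%nat = g n.

(* Main.v *)
(* Call [k ^ a * n + r] with [r < k ^ a] a descendant of [n]; the descendants of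
   [n] at level [a] form the block of [n].

   Local periodicity. Let [s] be a recurrent state of the automaton fixed by the
   digit [0]. At the scale [L = k ^ a], compare the grids of multiples of [L] and
   of a power [R] of [l] with [L <= R <= l * L], far away in a block of [s], where
   the exceptional set of level [R] is avoided. Among boundedly many multiples
   [n * L] two carry the same base-[k] label, the same base-[l] labels, and have
   almost the same offset to the [R]-grid; the difference of the offsets is a
   period of the block of [s], short compared with [L], and nonzero because
   [L * u = R * v] has no small solutions. Short periods at all consecutive scales
   must coincide, so the infinite word generated by [s] is periodic. Hence almost
   every integer lies in a block on which [f] has a fixed period [p].

   Global periodicity. The sequence [F n = f (p * n + i)] satisfies
   [F (n + 1) = F n] almost everywhere, so the finiteness of both kernels makes it
   almost invariant under multiplication by a power of [k] and by a power of [l],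
   hence under [n |-> n * X %/ Y] for a set of ratios [X / Y] that is dense in the
   positive reals. Such a map carries a positive proportion of any block into any
   other one, so [F] takes the same value on all of them. *)
Require Import Defs.
From Stdlib Require Import Reals Lra Lia Classical FunctionalExtensionality.
From Coquelicot Require Import Coquelicot.
From mathcomp Require Import all_boot zify.

Set Implicit Arguments.
Unset Strict Implicit.
Unset Printing Implicit Defensive.
(* The key [R] of the real scope is taken over by the ring scope. *)
Delimit Scope R_scope with real.
Local Open Scope nat_scope.

(** * Sets of density one *)

Lemma count_belowD (A : nat -> bool) m n :
  count_below A (m + n) = count_below A m + count_below (fun i => A (m + i)) n.
Proof.
rewrite /count_below iotaD count_cat add0n; congr (_ + _).
by rewrite -{1}[m]addn0 iotaDl count_map.
Qed.

Lemma count_belowS (A : nat -> bool) n :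
  count_below A n.+1 = count_below A n + A n.
Proof. by rewrite -addn1 count_belowD /count_below /= addn0 addn0. Qed.

Lemma count_below_le (A : nat -> bool) n : count_below A n <= n.
Proof. by rewrite -{2}(size_iota 0 n) /count_below count_size. Qed.

Lemma count_below_sub (A B : nat -> bool) n :
  (forall i, i < n -> A i -> B i) -> count_below A n <= count_below B n.
Proof.
elim: n => [//|n IH] AB; rewrite !count_belowS leq_add ?IH //.
  by move=> i lt_in; apply: AB; apply: ltnW.
by case An: (A n) => //; rewrite (AB n).
Qed.

Lemma count_below_mono (A : nat -> bool) m n :
  m <= n -> count_below A m <= count_below A n.
Proof. by move=> /subnKC <-; rewrite count_belowD leq_addr. Qed.

Lemma count_belowU (A B : nat -> bool) n :
  count_below (fun i => A i || B i) n <= count_below A n + count_below B n.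
Proof. by elim: n => [//|n IH]; rewrite !count_belowS; case: (A n); case: (B n); lia. Qed.

Lemma count_below0 (A : nat -> bool) n :
  (forall i, i < n -> ~~ A i) -> count_below A n = 0.
Proof.
elim: n => [//|n IH] nA; rewrite count_belowS IH ?(negbTE (nA n _)) // => i lt_in.
by apply: nA; apply: ltnW.
Qed.

Lemma count_below_window (A : nat -> bool) C n :
  (forall i j, A i -> A j -> j <= i + C) -> count_below A n <= C.+1.
Proof.
move=> AC; elim: n => [//|n IH]; rewrite count_belowS.
case An: (A n); last by rewrite addn0.
case: (leqP n C) => [le_nC|lt_Cn]; first by have := count_below_le A n; lia.
rewrite -(subnK (ltnW lt_Cn)) count_belowD (count_below0 (n := n - C)).
  by have := count_below_le (fun i => A (n - C + i)) C; lia.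
by move=> i lt_i; apply/negP => Ai; have := AC i n Ai An; lia.
Qed.

(** Each value of [phi] is taken only within a window of [C.+1] integers, so an element of [A] is
    counted at most [C.+1] times. *)
Lemma count_below_comp (A : nat -> bool) (phi : nat -> nat) C M N :
  (forall n, n < N -> phi n < M) ->
  (forall i j, phi i = phi j -> j <= i + C) ->
  count_below (fun n => A (phi n)) N <= C.+1 * count_below A M.
Proof.
move=> ltM fibC.
suff H m : count_below (fun n => A (phi n) && (phi n < m)) N
    <= C.+1 * count_below A m.
  apply: leq_trans (H M); apply: count_below_sub => i /ltM lt_i Ai.
  by rewrite Ai.
elim: m => [|m IH].
  by rewrite count_below0 // => i _; rewrite ltn0 andbF.
apply: (@leq_trans (count_below (fun n => A (phi n) && (phi n < m)) N
    + count_below (fun n => A m && (phi n == m)) N)).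
  apply: leq_trans (count_belowU _ _ _); apply: count_below_sub => i _ /=.
  by rewrite ltnS leq_eqVlt => /andP[Ai /orP[/eqP e|->]]; rewrite ?Ai // -e Ai eqxx orbT.
rewrite count_belowS mulnDr leq_add //; case: (A m) => /=; last by rewrite count_below0.
rewrite muln1; apply: count_below_window => i j /eqP ei /eqP ej.
by apply: fibC; rewrite ei ej.
Qed.

(** Density zero in integer terms: for every positive [c] the proportion is eventually at most
    [1 / c]. *)
Definition null (A : nat -> bool) : Prop :=
  forall c, exists N0, forall N, N0 <= N -> c * count_below A N <= N.

Definition almost_all (P : nat -> Prop) : Prop :=
  exists2 A, null A & forall n, ~~ A n -> P n.

Lemma almost_all_impl (P Q : nat -> Prop) :
  (forall n, P n -> Q n) -> almost_all P -> almost_all Q.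
Proof. by move=> PQ [A A0 AP]; exists A => // n /AP /PQ. Qed.

Lemma almost_allT (P : nat -> Prop) : (forall n, P n) -> almost_all P.
Proof.
move=> PT; exists (fun _ => false) => [c|n _]; last exact: PT.
by exists 0 => N _; rewrite count_below0 // muln0.
Qed.

Lemma almost_all_and (P Q : nat -> Prop) :
  almost_all P -> almost_all Q -> almost_all (fun n => P n /\ Q n).
Proof.
move=> [A A0 AP] [B B0 BQ]; exists (fun n => A n || B n); last first.
  by move=> n; rewrite negb_or => /andP[/AP ? /BQ ?].
move=> c; have [N1 H1] := A0 (2 * c); have [N2 H2] := B0 (2 * c).
exists (maxn N1 N2) => N; rewrite geq_max => /andP[/H1 {}H1 /H2 {}H2].
have := leq_mul (leqnn c) (count_belowU A B N); rewrite mulnDr; lia.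
Qed.

Lemma almost_all_lt W (P : nat -> nat -> Prop) :
  (forall i, i < W -> almost_all (P i)) ->
  almost_all (fun n => forall i, i < W -> P i n).
Proof.
elim: W => [|W IH] H; first exact: almost_allT.
have /IH H1 : forall i, i < W -> almost_all (P i) by move=> i lt; apply: H; apply: ltnW.
apply: almost_all_impl (almost_all_and H1 (H W (leqnn _))) => n [a b] i.
by rewrite ltnS leq_eqVlt => /orP[/eqP ->|/a].
Qed.

Lemma almost_all_comp (P : nat -> Prop) (phi : nat -> nat) C :
  (forall n, phi n <= C * n + C) ->
  (forall i j, phi i = phi j -> j <= i + C) ->
  almost_all P -> almost_all (fun n => P (phi n)).
Proof.
move=> grow fib [A A0 AP]; exists (fun n => A (phi n)) => [c|n /AP //].
(* [C.+1] accounts for the fibres, [(C + C).+1] for the bound [C * N + C.+1] on the values of [phi]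
   below [N]. *)
have [N0 H] := A0 (c * C.+1 * (C + C).+1).
exists N0.+1 => N lt_N.
have ltM n : n < N -> phi n < C * N + C.+1.
  by move=> lt_n; apply: leq_ltn_trans (grow n) _; rewrite addnS ltnS leq_add2r leq_mul2l ltnW ?orbT.
have le1 := count_below_comp A ltM fib.
have C0 : 0 < C.
  by case: (C) grow fib => // g fb; have := fb 0 1; move: (g 0) (g 1); lia.
have /H le2 : N0 <= C * N + C.+1 by nia.
have le3 : C * N + C.+1 <= (C + C).+1 * N by nia.
rewrite -(leq_pmul2l (ltn0Sn (C + C))); apply: leq_trans le3; apply: leq_trans le2.
by rewrite mulnCA -mulnA -mulnA leq_mul2l [_ * ((C + C).+1 * _)]mulnCA leq_mul2l le1 !orbT.
Qed.

(** The candidates [n] number roughly [k ^ M / u] or more, a fixed proportion of the integers below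
    [hi * k ^ M]; a null set cannot contain them all once [M] is large. *)
Lemma almost_all_meets k (P : nat -> Prop) lo hi u v :
  1 < k -> 0 < u -> lo < hi -> almost_all P ->
  exists M0, forall M, M0 <= M -> exists n,
    [/\ P n, lo * k ^ M + v <= u * n & u * n + v <= hi * k ^ M].
Proof.
move=> k1 u0 lohi [A A0 AP].
(* This allows at most [k ^ M / (2 * u)] exceptions below [hi * k ^ M], about half of the
   candidates. *)
have [N0 H] := A0 (2 * u * hi).
exists (N0 + 8 * (u + v)) => M leM.
have kM : M < k ^ M by apply: ltn_expl.
move: (k ^ M) kM => K kM.
set x := (lo * K + v) %/ u; set y := (hi * K - v) %/ u.
have lex : lo * K + v < u * x.+1 by rewrite [u * _]mulnC /x ltn_ceil.
have lex' : u * x <= lo * K + v by rewrite [u * _]mulnC /x leq_trunc_div.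
have ley : u * y <= hi * K - v by rewrite [u * _]mulnC /y leq_trunc_div.
have ley' : hi * K - v < u * y.+1 by rewrite [u * _]mulnC /y ltn_ceil.
have hiK : lo * K + K <= hi * K by rewrite -mulSnr leq_mul2r lohi orbT.
have leK : K <= hi * K by lia.
have leyK : y <= hi * K by apply: leq_trans (leq_pmull y u0) _; lia.
case: (boolP (has (fun n => ~~ A n) (iota x.+1 (y - x)))) => [/hasP[n]|nA].
  rewrite mem_iota => /andP[xn ny] /AP Pn.
  have le1 : u * x.+1 <= u * n by rewrite leq_mul2l xn orbT.
  have le2 : u * n <= u * y by rewrite leq_mul2l; apply/orP; right; lia.
  have : 0 < hi * K - v by apply: leq_trans ley; rewrite muln_gt0 u0; lia.
  by exists n; split => //; lia.
have /H le : N0 <= hi * K by lia.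
have {}leyK : x.+1 + (y - x) <= (hi * K).+1.
  have : x <= hi * K by apply: leq_trans (leq_pmull x u0) _; lia.
  by lia.
have le2 : y - x <= (count_below A (hi * K)).+1.
  have := leq_trans (count_below_mono A leyK) _.
  move=> /(_ (count_below A (hi * K)).+1); rewrite count_belowS => /(_ _) le3.
  have {}le3 : count_below A (x.+1 + (y - x)) <= (count_below A (hi * K)).+1.
    by apply: le3; case: (A _); lia.
  apply: leq_trans le3; rewrite count_belowD.
  suff -> : count_below (fun i => A (x.+1 + i)) (y - x) = y - x by lia.
  rewrite /count_below; apply/eqP; rewrite -{2}(size_iota 0 (y - x)) -all_count.
  apply/allP => i; rewrite mem_iota => /andP[_ lti]; move/hasPn: nA => /(_ (x.+1 + i)).
  by rewrite mem_iota negbK; apply; lia.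
have : u * (y - x) <= u * (count_below A (hi * K)).+1 by rewrite leq_mul2l le2 orbT.
rewrite mulnBr mulnS => le4.
have le5 : 2 * hi * (u * count_below A (hi * K)) <= hi * K by lia.
have le6 : 2 * hi * (K - 2 * v - 3 * u) <= 2 * hi * (u * count_below A (hi * K)).
  by rewrite leq_mul2l; apply/orP; right; lia.
have : hi * (2 * (K - 2 * v - 3 * u)) <= hi * K by lia.
by rewrite leq_pmul2l; lia.
Qed.

Lemma asym_eq_almost_all (Omega : finType) (f g : nat -> Omega) :
  asym_eq f g <-> almost_all (fun n => f n = g n).
Proof.
pose u A N := (INR (count_below A N) / INR N)%real.
have u0 A N : (0 <= u A N)%real.
  (* At [N = 0] the quotient is [0] because its numerator is. *)
  rewrite /u; case: N => [|N]; first by rewrite /count_below /= /Rdiv Rmult_0_l; lra.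
  by apply: Rdiv_le_0_compat; [exact: pos_INR | apply: lt_0_INR; lia].
split=> [fg|[A A0 Afg]].
  exists (fun n => f n != g n) => [c|n /negPn/eqP //].
  have := proj2_sig (ex_LimSup_seq (u (fun n => f n != g n))).
  rewrite -/(LimSup_seq _) -/(upper_density _) fg => lim.
  have e0 : (0 < / (INR c + 1))%real by apply: Rinv_0_lt_compat; have := pos_INR c; lra.
  have [_ [N0 H]] := lim (mkposreal _ e0).
  exists N0.+1 => N ltN; have /= := H N ltac:(lia); rewrite Rplus_0_l => lt.
  have N0' : (0 < INR N)%real by apply: lt_0_INR; lia.
  have c0 := pos_INR c.
  apply/leP/INR_le; rewrite -multE mult_INR.
  set w := INR (count_below _ _) in lt *.
  have w0 : (0 <= w)%real by exact: pos_INR.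
  have : (w * (INR c + 1) < INR N)%real.
    have pos : (0 < INR N * (INR c + 1))%real by nra.
    have := Rmult_lt_compat_r _ _ _ pos lt.
    have -> : (w / INR N * (INR N * (INR c + 1)) = w * (INR c + 1))%real by field; lra.
    by have -> : (/ (INR c + 1) * (INR N * (INR c + 1)) = INR N)%real by field; lra.
  nra.
apply: is_LimSup_seq_unique => eps /=; split.
  move=> N; exists N; split; first lia.
  by have := u0 (fun n => f n != g n) N; rewrite /u; have := cond_pos eps; lra.
have [c [c0 ce]] : exists c, (0 < INR c /\ 1 < INR c * eps)%real.
  have [c Hc] := INR_unbounded (1 / eps); exists c.
  have e0 := cond_pos eps.
  have : (0 < 1 / eps)%real by apply: Rdiv_lt_0_compat; lra.
  split; first lra.
  have <- : (1 / eps * eps = 1)%real by field; lra.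
  by apply: Rmult_lt_compat_r.
have [N0 H] := A0 c; exists N0.+1 => N ltN; rewrite Rplus_0_l.
have N0' : (0 < INR N)%real by apply: lt_0_INR; lia.
have le1 : c * count_below (fun n => f n != g n) N <= N.
  apply: leq_trans (H N ltac:(lia)); rewrite leq_mul2l; apply/orP; right.
  by apply: count_below_sub => i _; apply: contraR => /Afg ->.
move: le1 => /leP/le_INR; rewrite -multE mult_INR => le1.
set w := INR (count_below _ _) in le1 *.
have w0 : (0 <= w)%real by exact: pos_INR.
apply: (Rmult_lt_reg_r (INR N)) => //.
have -> : (w / INR N * INR N)%real = w by field; lra.
nra.
Qed.

(** * Labels of integers in the two bases *)

(** With a relation in place of a function, existence statements serve directly as labels;
    [fin_all_exists] makes the finitely many choices. *)
Lemma pigeonhole (T : finType) (R : nat -> T -> Prop) :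
  (forall i, exists t, R i t) ->
  exists i j t, [/\ i < j, j <= #|T|, R i t & R j t].
Proof.
move=> H.
have [phi Hphi] : exists phi : 'I_(#|T|.+1) -> T, forall i : 'I_(#|T|.+1), R i (phi i).
  by apply: (@fin_all_exists _ (fun=> T) (fun i t => R (val i) t)) => i; apply: H.
have : ~~ injectiveb phi.
  by apply/negP => /injectiveP/leq_card; rewrite card_ord ltnn.
move=> /injectivePn[x [y nxy exy]].
have := nxy; rewrite -val_eqE neq_ltn => /orP[lt|lt].
  by exists x, y, (phi x); split => //; [rewrite -ltnS | rewrite exy].
by exists y, x, (phi x); split => //; [rewrite -ltnS | rewrite exy].
Qed.

Lemma uniform_bound (Q : finType) (P : Q -> nat -> Prop) :
  (forall q, exists D, forall D', D <= D' -> P q D') -> exists D, forall q, P q D.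
Proof.
move=> /fin_all_exists[D HD]; exists (\max_q D q) => q.
by apply: HD; apply: leq_bigmax.
Qed.

(* [tau n] stands for the state of a [k]-automaton computing [f] after it has
   read [n], most significant digit first. *)
Definition labelling (Q : finType) (Omega : Type) k (f : nat -> Omega)
    (tau : nat -> Q) : Prop :=
  (forall n n' d, d < k -> tau n = tau n' -> tau (k * n + d) = tau (k * n' + d)) /\
  (forall n n', tau n = tau n' -> f n = f n').

Lemma labelling_desc (Q : finType) (Omega : Type) k (f : nat -> Omega)
    (tau : nat -> Q) n n' a r :
  labelling k f tau -> r < k ^ a -> tau n = tau n' ->
  tau (k ^ a * n + r) = tau (k ^ a * n' + r).
Proof.
move=> [step _]; elim: a r => [|a IH] r lt_r e.
  by move: lt_r; rewrite expn0 ltnS leqn0 => /eqP ->; rewrite !mul1n !addn0.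
have k0 : 0 < k by case: (k) lt_r => //; rewrite exp0n.
have E m : k ^ a.+1 * m + r = k * (k ^ a * m + r %/ k) + r %% k.
  by rewrite {1}(divn_eq r k) expnS; lia.
rewrite !E; apply: step; first by rewrite ltn_mod.
by apply: IH => //; rewrite ltn_divLR // -expnSr.
Qed.

Lemma labelling_block (Q : finType) (Omega : Type) k (f : nat -> Omega)
    (tau : nat -> Q) n n' a r :
  labelling k f tau -> r < k ^ a -> tau n = tau n' ->
  f (k ^ a * n + r) = f (k ^ a * n' + r).
Proof. by move=> lab lt e; apply: (lab.2); apply: (labelling_desc lab). Qed.

Lemma labelling_pow (Q : finType) (Omega : Type) k (f : nat -> Omega)
    (tau : nat -> Q) h :
  labelling k f tau -> labelling (k ^ h) f tau.
Proof.
move=> lab; split=> [n n' d lt e|n n']; last exact: (lab.2).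
exact: (labelling_desc lab).
Qed.

(** [finite_set] gives only a covering list; classical logic discards the foreign entries, so that
    labels read off the list depend on [P] alone. *)
Lemma finite_set_exact (T : Type) (P : T -> Prop) :
  finite_set P -> exists s : list T, forall x, List.In x s <-> P x.
Proof.
move=> [s]; elim: s P => [|y s IH] P HP.
  by exists nil => x; split => // /HP.
have [s' Hs'] : exists s' : list T, forall x, List.In x s' <-> (P x /\ x <> y).
  by apply: IH => x [/HP[] // -> []].
have [Py|nPy] := classic (P y).
  exists (y :: s') => x /=; split => [[<-|/Hs'[]]//|Px].
  by have [->|ne] := classic (x = y); [left | right; apply/Hs'].
exists s' => x; split => [/Hs'[]//|Px]; apply/Hs'; split => // e.
by apply: nPy; rewrite -e.
Qed.

Lemma eq_map_eval (Omega : Type) (s : seq (nat -> Omega)) n n' :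
  [seq g n | g <- s] = [seq g n' | g <- s] <-> forall g, List.In g s -> g n = g n'.
Proof.
elim: s => [|h s IH] /=; first by split.
split=> [[e /IH H] g [<-|/H]//|H]; congr (_ :: _); first by apply: H; left.
by apply/IH => g Hg; apply: H; right.
Qed.

(** The label of [n] is the vector of values at [n] of all kernel sequences. Their values at
    [k * n + d] are again values at [n] of kernel sequences. *)
Lemma automatic_labelling (Omega : finType) k (f : nat -> Omega) :
  automatic k f -> exists (Q : finType) (tau : nat -> Q), labelling k f tau.
Proof.
move=> /finite_set_exact[s Hs].
pose tau n := map_tuple (fun g : nat -> Omega => g n) (in_tuple s).
have tauP n n' : tau n = tau n' <-> forall g, kernel k f g -> g n = g n'.
  split=> [/(congr1 val)/eq_map_eval H g /Hs/H //|H].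
  by apply: val_inj; apply/eq_map_eval => g /Hs/H.
exists ((size s).-tuple Omega : finType), tau; split=> [n n' d lt_d /tauP e|n n' /tauP e].
  apply/tauP => _ [a [r [lt_r ->]]].
  have E m : k ^ a * (k * m + d) + r = k ^ a.+1 * m + (k ^ a * d + r).
    by rewrite expnS; lia.
  rewrite !E; apply: (e (fun m => f (k ^ a.+1 * m + (k ^ a * d + r)))).
  exists a.+1, (k ^ a * d + r); split => //.
  apply: (@leq_trans (k ^ a * d.+1)); first by rewrite mulnS; lia.
  by rewrite expnSr leq_mul2l lt_d orbT.
apply: (e f); exists 0, 0; split => //.
by apply: functional_extensionality => m; rewrite expn0 mul1n addn0.
Qed.

Lemma automatic_asym_automatic (Omega : finType) k (f : nat -> Omega) :
  automatic k f -> asym_automatic k f.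
Proof.
move=> [s Hs]; exists (List.map (fun g h => asym_eq g h) s) => _ [g [/Hs Hg ->]].
exact: (List.in_map (fun g h => asym_eq g h)).
Qed.

Lemma asym_eq_refl (Omega : finType) (f : nat -> Omega) : asym_eq f f.
Proof. by apply/asym_eq_almost_all; apply: almost_allT. Qed.

Lemma asym_representatives (Omega : finType) l (f : nat -> Omega) :
  asym_automatic l f -> exists (m : nat) (G : 'I_m -> nat -> Omega),
  forall b r, r < l ^ b ->
    exists i, almost_all (fun n => f (l ^ b * n + r) = G i n).
Proof.
move=> [s Hs].
(* The list [s] consists of classes: an entry that is the class of some [g0] contributes [g0], any
   other is dropped. *)
have [gs Hgs] : exists gs : seq (nat -> Omega), forall g,
    List.In (fun h => asym_eq g h) s -> exists2 i, i < size gs & asym_eq g (nth f gs i).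
  elim: (s) => [|C t [gs Hgs]]; first by exists [::].
  have [[g0 eC]|nC] := classic (exists g, C = (fun h => asym_eq g h)).
    exists (g0 :: gs) => g [e|/Hgs[i lt_i Hi]]; last by exists i.+1.
    exists 0 => //=; have := asym_eq_refl g0.
    by rewrite -[asym_eq g0 g0]/((fun h => asym_eq g0 h) g0) -eC e.
  exists gs => g [e|/Hgs //]; by case: nC; exists g.
exists (size gs), (fun i => nth f gs i) => b r lt_r.
have [|i lt_i Hi] := Hgs (fun n => f (l ^ b * n + r)).
  by apply: Hs; exists (fun n => f (l ^ b * n + r)); split => //; exists b, r.
by exists (Ordinal lt_i); apply/asym_eq_almost_all.
Qed.

(** The analogue of [labelling] in base [l], taken level by level: the exceptional set may depend on
    [b]. *)
Definition asym_label (S : finType) (Omega : Type) l (f : nat -> Omega)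
    (sigma : nat -> S) : Prop :=
  forall b, exists2 typical : nat -> Prop, almost_all typical &
    forall m m', typical m -> typical m' -> sigma m = sigma m' ->
    forall r, r < l ^ b -> f (l ^ b * m + r) = f (l ^ b * m' + r).

(** The label lists the values of the representatives; each of the finitely many descendants at
    level [b] is almost everywhere given by one of them. *)
Lemma asym_labelling (Omega : finType) l (f : nat -> Omega) :
  asym_automatic l f -> exists (S : finType) (sigma : nat -> S),
  asym_label l f sigma.
Proof.
move=> /asym_representatives[m [G HG]].
exists ({ffun 'I_m -> Omega} : finType), (fun n => [ffun i => G i n]) => b.
have [idx Hidx] : exists idx : 'I_(l ^ b) -> 'I_m,
    forall r : 'I_(l ^ b), almost_all (fun n => f (l ^ b * n + r) = G (idx r) n).
  apply: (@fin_all_exists _ (fun=> 'I_m)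
    (fun r i => almost_all (fun n => f (l ^ b * n + val r) = G i n))) => r.
  exact: (HG b r (ltn_ord r)).
exists (fun n => forall r, r < l ^ b -> forall lt_r : r < l ^ b,
    f (l ^ b * n + r) = G (idx (Ordinal lt_r)) n).
  apply: almost_all_lt => r lt_r.
  apply: almost_all_impl (Hidx (Ordinal lt_r)) => n /= -> lt_r'.
  by rewrite (bool_irrelevance lt_r lt_r').
move=> n n' Hn Hn' /ffunP e r lt_r.
by rewrite (Hn r lt_r lt_r) (Hn' r lt_r lt_r); have := e (idx (Ordinal lt_r)); rewrite !ffunE.
Qed.

(** For one fixed offset [i], infinitely many levels share finitely many representatives. *)
Lemma asym_recurrence (Omega : finType) l (f : nat -> Omega) i :
  1 < l -> asym_automatic l f -> exists b b', [/\ i < l ^ b, b < b' &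
    almost_all (fun n => f (l ^ b * n + i) = f (l ^ b' * n + i))].
Proof.
move=> l1 /asym_representatives[m [G HG]].
have lt_i j : i < l ^ (i + j).
  by apply: leq_trans (ltn_expl i l1) _; rewrite leq_exp2l // leq_addr.
have [j [j' [t [ltj _ Hj Hj']]]] := pigeonhole (fun j => HG (i + j) i (lt_i j)).
exists (i + j), (i + j'); split; rewrite ?ltn_add2l //.
by apply: almost_all_impl (almost_all_and Hj Hj') => n [-> ->].
Qed.

(* Multiplication by [k ^ h] acts on labels as the [h]-th iterate of one self-map
   of a finite set. *)
Lemma labelling_idempotent (Q : finType) (Omega : Type) k (f : nat -> Omega)
    (tau : nat -> Q) :
  1 < k -> labelling k f tau -> exists2 h, 0 < h &
  forall n, tau (k ^ h * (k ^ h * n)) = tau (k ^ h * n).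
Proof.
move=> k1 lab.
have [rep Hrep] : exists rep : Q -> nat, forall q, forall n, tau n = q -> tau (rep q) = q.
  apply: (@fin_all_exists _ (fun=> nat) (fun q m => forall n, tau n = q -> tau m = q)) => q.
  have [[n Hn]|nex] := classic (exists n, tau n = q); first by exists n.
  by exists 0 => n Hn; case: nex; exists n.
have [i [j [t [ltij _ /= Hi Hj]]]] := @pigeonhole {ffun Q -> Q}
  (fun i t => t = [ffun q => tau (k ^ i * rep q)]) (fun i => ex_intro _ _ erefl).
have E n : tau (k ^ i * n) = tau (k ^ j * n).
  have Et e : tau (k ^ e * n) = tau (k ^ e * rep (tau n)).
    rewrite -[k ^ e * n]addn0 -[k ^ e * rep _]addn0.
    by apply: (labelling_desc lab); rewrite ?expn_gt0 ?(ltnW k1) // (Hrep (tau n) n).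
  have := congr1 (fun t : {ffun Q -> Q} => t (tau n)) (etrans (esym Hi) Hj).
  by rewrite !Et !ffunE.
have E' c m n : i <= m -> tau (k ^ (m + c * (j - i)) * n) = tau (k ^ m * n).
  elim: c m => [|c IH] m le_im; first by rewrite addn0.
  have -> : m + c.+1 * (j - i) = (m + (j - i)) + c * (j - i) by rewrite mulSn addnA.
  rewrite IH; last by lia.
  have -> : m + (j - i) = j + (m - i) by lia.
  rewrite -{2}(subnKC le_im) !expnD -!mulnA.
  by rewrite E.
(* This exponent is a multiple of the period [j - i] of the iterates and exceeds the preperiod
   [i]. *)
exists (i.+1 * (j - i)) => [|n]; first by rewrite muln_gt0 subn_gt0.
by rewrite mulnA -expnD E' // mulSn; nia.
Qed.

(** If some descendant of [m] cannot regain the label of [m], pass to it: the finite set [A] of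
    available labels loses an element, so this ends. *)
Lemma recurrent_descendant (Q : finType) (tau : nat -> Q) k n :
  1 < k -> exists a r, r < k ^ a /\
  forall a' r', r' < k ^ a' -> exists a'' r'', r'' < k ^ a'' /\
    tau (k ^ a'' * (k ^ a' * (k ^ a * n + r) + r') + r'') = tau (k ^ a * n + r).
Proof.
move=> k1.
have desc_trans a r a' r' m : r < k ^ a -> r' < k ^ a' ->
    k ^ a' * r + r' < k ^ (a' + a) /\
    k ^ a' * (k ^ a * m + r) + r' = k ^ (a' + a) * m + (k ^ a' * r + r').
  move=> lt lt'; split; last by rewrite expnD; lia.
  apply: (@leq_trans (k ^ a' * r.+1)); first by rewrite mulnS; lia.
  by rewrite expnD leq_mul2l lt orbT.
suff H (A : {set Q}) m : (forall a r, r < k ^ a -> tau (k ^ a * m + r) \in A) ->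
    exists a r, r < k ^ a /\ forall a' r', r' < k ^ a' -> exists a'' r'',
    r'' < k ^ a'' /\ tau (k ^ a'' * (k ^ a' * (k ^ a * m + r) + r') + r'')
      = tau (k ^ a * m + r).
  by apply: (H setT) => *; rewrite inE.
move: {2}#|A|.+1 (ltnSn #|A|) => c; elim: c A m => [//|c IH] A m ltA HA.
have [rec|nrec] := classic (forall a' r', r' < k ^ a' -> exists a'' r'',
    r'' < k ^ a'' /\ tau (k ^ a'' * (k ^ a' * m + r') + r'') = tau m).
  exists 0, 0; split => //; rewrite expn0 mul1n addn0; exact: rec.
have [a' [r' [lt' H']]] : exists a' r', r' < k ^ a' /\ forall a'' r'',
    r'' < k ^ a'' -> tau (k ^ a'' * (k ^ a' * m + r') + r'') <> tau m.
  apply: NNPP => nex; apply: nrec => a' r' lt'; apply: NNPP => nex'.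
  apply: nex; exists a', r'; split => // a'' r'' lt'' e.
  by apply: nex'; exists a'', r''.
have mA : tau m \in A by have := HA 0 0 isT; rewrite expn0 mul1n addn0.
have [||a [r [lt Hr]]] := IH (A :\ tau m) (k ^ a' * m + r').
- by have := cardsD1 (tau m) A; rewrite mA; lia.
- move=> a r lt; rewrite in_setD1; apply/andP; split; first by apply/eqP; apply: H'.
  by have [lt2 ->] := desc_trans _ _ _ _ m lt' lt; apply: HA.
have [lt2 E2] := desc_trans _ _ _ _ m lt' lt.
by exists (a + a'), (k ^ a * r' + r); split => //; rewrite -E2.
Qed.

(** * Local periods *)

Lemma almost_all_floor X Y Z (P : nat -> Prop) :
  0 < X -> 0 < Y -> almost_all P -> almost_all (fun n => P ((X * n + Z) %/ Y)).
Proof.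
move=> X0 Y0; apply: (@almost_all_comp _ _ (X + Y + Z)) => [n|i j e].
  by apply: leq_trans (leq_div _ _) _; rewrite !mulnDl; lia.
have lt : X * j < X * i + Y.
  have := divn_eq (X * j + Z) Y; rewrite -e.
  have := divn_eq (X * i + Z) Y; have := ltn_pmod (X * j + Z) Y0; lia.
suff : j <= i + Y by lia.
rewrite leqNgt; apply/negP => lt'; have : X * (i + Y).+1 <= X * j by rewrite leq_mul2l lt' orbT.
have : Y <= X * Y by rewrite leq_pmull.
by rewrite mulnS mulnDr; lia.
Qed.

Lemma almost_all_affine X Z (P : nat -> Prop) :
  0 < X -> almost_all P -> almost_all (fun n => P (X * n + Z)).
Proof.
move=> X0 /(@almost_all_floor X 1 Z _ X0 isT).
by apply: almost_all_impl => n; rewrite divn1.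
Qed.

(** Arithmetic form of independence: [k ^ i = l ^ j] would make the quotient of the logarithms
    [j / i]. *)
Definition powers_disjoint (k l : nat) : Prop :=
  forall i j, 0 < i -> k ^ i <> l ^ j.

Lemma INR_expn k i : INR (k ^ i) = (INR k ^ i)%real.
Proof. by elim: i => [|i IH]; rewrite ?expnS // -multE mult_INR IH. Qed.

Lemma ln_INR_gt0 l : 1 < l -> (0 < ln (INR l))%real.
Proof.
by move=> l1; rewrite -ln_1; apply: ln_increasing; [lra | apply: (lt_INR 1); lia].
Qed.

Lemma mult_indep_powers_disjoint k l :
  1 < k -> 1 < l -> mult_indep k l -> powers_disjoint k l.
Proof.
move=> k1 l1 indep i j i0 e; apply: indep.
have lnl := ln_INR_gt0 l1.
have i0' : (0 < INR i)%real by apply: lt_0_INR; lia.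
exists (Z.of_nat j), (Z.of_nat i); split; first by lia.
rewrite -!INR_IZR_INZ.
have := congr1 (fun n => ln (INR n)) e.
rewrite !INR_expn !ln_pow; try by apply: lt_0_INR; lia.
move=> E; apply: (Rmult_eq_reg_r (INR i * ln (INR l))); last by nra.
field_simplify; try lra; nra.
Qed.

Lemma powers_disjoint_pow k l h :
  0 < h -> powers_disjoint k l -> powers_disjoint (k ^ h) l.
Proof. by move=> h0 d i j i0; rewrite -expnM; apply: d; rewrite muln_gt0 h0. Qed.

(** For a fixed pair [(u, v)], two solutions with distinct [a] would divide into a coincidence of a
    power of [k] with one of [l]. So each of the finitely many pairs rules out at most one [a]. *)
Lemma eventually_incommensurable k l W :
  1 < k -> 1 < l -> powers_disjoint k l -> exists a0, forall a b u v,
  a0 <= a -> 0 < u -> u <= W -> v <= W -> k ^ a * u <> l ^ b * v.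
Proof.
move=> k1 l1 disj.
have [|a0 H] := @uniform_bound ('I_W.+1 * 'I_W.+1)%type
   (fun q D => forall a b, D <= a -> 0 < q.1 -> k ^ a * q.1 <> l ^ b * q.2).
  move=> [u v] /=.
  have [[a1 [b1 e1]]|nex] := classic (exists a b, k ^ a * u = l ^ b * v); last first.
    by exists 0 => D _ a b _ _ e; apply: nex; exists a, b.
  exists a1.+1 => D ltD a b leD u0 e.
  have lta : a1 < a by lia.
  have v0 : 0 < v.
    rewrite lt0n; apply/eqP => v0; move: e1; rewrite v0 muln0 => /eqP.
    by rewrite muln_eq0 expn_eq0; lia.
  have E : k ^ (a - a1) * l ^ b1 = l ^ b.
    apply/eqP; rewrite -(eqn_pmul2r v0) -e -mulnA -e1 mulnA -expnD subnK //.
    exact: ltnW.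
  have a1' : 0 < a - a1 by rewrite subn_gt0.
  case: (leqP b1 b) => [leb|ltb].
    apply: (disj (a - a1) (b - b1) a1').
    have l0 : 0 < l ^ b1 by rewrite expn_gt0; lia.
    by apply/eqP; rewrite -(eqn_pmul2r l0) E -expnD subnK.
  have : l ^ b < l ^ b1 by rewrite ltn_exp2l.
  have : l ^ b1 <= k ^ (a - a1) * l ^ b1 by rewrite leq_pmull // expn_gt0; lia.
  by rewrite E; lia.
exists a0 => a b u v lea u0 leu lev.
by have := H (inord u, inord v) a b lea; rewrite /= !inordK //; apply.
Qed.

Lemma power_between l L : 1 < l -> 0 < L -> exists b, L <= l ^ b <= l * L.
Proof.
move=> l1 L0.
have ex : exists b, L <= l ^ b by exists L; apply: ltnW; apply: ltn_expl.
case: (ex_minnP ex) => b leb minb; exists b; rewrite leb /=.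
case: b leb minb => [|b] leb minb; first by rewrite expn0; nia.
rewrite expnS leq_mul2l; apply/orP; right; rewrite leqNgt; apply/negP => lt.
by have := minb b (ltnW lt); rewrite ltnn.
Qed.

Definition block_period (Omega : Type) k (f : nat -> Omega) s a p : Prop :=
  forall j, j + p < k ^ a -> f (k ^ a * s + (j + p)) = f (k ^ a * s + j).

(* Two places [n, n'] carrying the same base-[k] label, whose positions in the
   grid of multiples of [R = l ^ b] carry the same base-[l] labels, see the same
   word of [f] twice: their offsets to the grid then differ by a local period. *)
Lemma short_block_period (Q S : finType) (Omega : Type) k l (f : nat -> Omega)
    (tau : nat -> Q) (sigma : nat -> S) s D J :
  1 < k -> 1 < l -> powers_disjoint k l -> labelling k f tau ->
  asym_label l f sigma ->
  (forall a r, r < k ^ a -> exists2 r', r' < k ^ D &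
    tau (k ^ D * (k ^ a * s + r) + r') = tau s) ->
  exists a0, forall a, a0 <= a ->
  exists p, [/\ 0 < p, J * p <= k ^ a & block_period k f s a p].
Proof.
move=> k1 l1 disj lab asym ret.
(* Offsets in the same bin differ by some [p] with [p * B <= R], and [R <= l * k ^ (a + D)] turns
   this into [J * p <= k ^ a]. *)
pose B := J * l * k ^ D.
pose T : finType := (Q * S * S * 'I_B.+1)%type.
have [a0 incomm] := eventually_incommensurable #|T| k1 l1 disj.
(* The [D] extra levels leave room for a descendant labelled like [s] whose own block has length
   [k ^ a]. *)
exists a0 => a lea; set L := k ^ (a + D).
have L0 : 0 < L by rewrite expn_gt0; lia.
have [b /andP[leLR leRL]] := power_between l1 L0.
have [typical aat typP] := asym b.
move: (l ^ b) leLR leRL typP (fun u v => incomm (a + D) b u v (leq_trans lea (leq_addr _ _)))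
  => R leLR leRL typP {}incomm.
have R0 : 0 < R by lia.
pose m n := n * L %/ R; pose o n := n * L %% R.
have mo n : n * L = m n * R + o n by rewrite -divn_eq.
have o_lt n : o n < R by rewrite ltn_mod.
(* A word of length [L <= R] starting at an offset below [R] stays within two consecutive cells of
   the [R]-grid, so both are required to be typical. *)
have aaW : almost_all (fun n => forall i, i < #|T|.+1 ->
    typical (m (n + i)) /\ typical (m (n + i)).+1).
  apply: almost_all_lt => i _.
  have aat' := almost_all_affine 1 (ltn0Sn 0) aat.
  have := almost_all_floor (i * L) L0 R0 (almost_all_and aat aat').
  by apply: almost_all_impl => n; rewrite mul1n addn1 /m mulnDl [L * n]mulnC.
have [M0 HM0] := almost_all_meets (#|T|.+1) k1 (ltn0Sn 0) (ltnSn s) aaW.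
have [N0 [win lo hi]] := HM0 M0 (leqnn _); rewrite !mul1n in lo hi.
pose key i := (tau (N0 + i), sigma (m (N0 + i)), sigma (m (N0 + i)).+1,
   inord (o (N0 + i) * B %/ R) : 'I_B.+1) : T.
have desc i : i < #|T|.+1 -> exists2 r, r < k ^ M0 & N0 + i = k ^ M0 * s + r.
  move=> lti; exists (N0 + i - k ^ M0 * s); last by rewrite [k ^ _ * _]mulnC; lia.
  by move: hi; rewrite mulSn [k ^ _ * _]mulnC; lia.
have same_word i j t : i < #|T|.+1 -> j < #|T|.+1 -> key i = key j ->
    t < 2 * R -> f (m (N0 + j) * R + t) = f (m (N0 + i) * R + t).
  move=> lti ltj [_ es es' _] lt_t.
  have [ti ti'] := win i lti; have [tj tj'] := win j ltj.
  have [lt|ge] := ltnP t R; first by rewrite ![_ * R]mulnC; apply: typP.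
  have E n : n * R + t = R * n.+1 + (t - R) by rewrite mulnS [R * n]mulnC; lia.
  by rewrite !E; apply: typP => //; lia.
have same_bin i j : key i = key j -> o (N0 + i) <= o (N0 + j) ->
    (o (N0 + j) - o (N0 + i)) * B <= R.
  have bin_lt n : o n * B %/ R < B.+1.
    rewrite ltnS; apply: leq_trans (leq_div2r R (leq_mul (ltnW (o_lt n)) (leqnn B))) _.
    by rewrite mulKn.
  move=> [_ _ _ /(congr1 val)] /=; rewrite !inordK // => e le.
  have := divn_eq (o (N0 + j) * B) R; rewrite -e.
  have := divn_eq (o (N0 + i) * B) R; have := ltn_pmod (o (N0 + j) * B) R0.
  by rewrite mulnBl; lia.
have claim i j : i < #|T|.+1 -> j < #|T|.+1 -> key i = key j ->
    o (N0 + i) < o (N0 + j) ->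
    exists p, [/\ 0 < p, J * p <= k ^ a & block_period k f s a p].
  move=> lti ltj eij lto; have leB := same_bin i j eij (ltnW lto).
  exists (o (N0 + j) - o (N0 + i)); split; first by rewrite subn_gt0.
    have k0 : 0 < l * k ^ D by rewrite muln_gt0 expn_gt0; lia.
    rewrite -(leq_pmul2r k0); apply: leq_trans (leq_trans leRL _).
      by apply: leq_trans leB; rewrite /B; lia.
    by rewrite /L expnD; lia.
  set p := o (N0 + j) - o (N0 + i) in leB *.
  (* The base-[k] label exchanges [N0 + i] and [N0 + j], the base-[l] labels exchange their cells;
     the net effect is a shift by [p]. *)
  have per t : t < L -> f ((N0 + i) * L + (t + p)) = f ((N0 + i) * L + t).
    move=> lt_t; have [etau _ _ _] := eij.
    rewrite [(N0 + i) * L in RHS]mulnC (labelling_block lab lt_t etau) -/L [L * _]mulnC (mo (N0 + j)).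
    rewrite -addnA (same_word i j) //; last by have := o_lt (N0 + j); lia.
    by rewrite (mo (N0 + i)) -addnA; congr (f (_ + _)); rewrite /p; lia.
  (* [N0 + i] is a descendant of [s], and [ret] leads from it back to the label of [s], which
     carries the period to the block of [s]. *)
  have [r lt_r er] := desc i lti.
  have [r' lt_r' er'] := ret M0 r lt_r.
  move=> t lt_t; rewrite -er in er'.
  have lt_t' : t < k ^ a by lia.
  rewrite -!(labelling_block lab _ er') //.
  have E x : k ^ a * (k ^ D * (N0 + i) + r') + x = (N0 + i) * L + (k ^ a * r' + x).
    by rewrite /L expnD; lia.
  rewrite !E [k ^ a * r' + (t + p)]addnA per //.
  apply: (@leq_trans (k ^ a * r'.+1)); first by rewrite mulnS; lia.
  by rewrite /L expnD leq_mul2l lt_r' orbT.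
have [i [j [t [ltij lej ei ej]]]] := pigeonhole (fun i => ex_intro (fun t => t = key i) _ erefl).
have ekey : key i = key j by rewrite -ei -ej.
have lti : i < #|T|.+1 by lia.
have ltj : j < #|T|.+1 by lia.
have [lt|gt|eo] := ltngtP (o (N0 + i)) (o (N0 + j)).
- exact: claim lti ltj ekey lt.
- exact: claim ltj lti (esym ekey) gt.
(* Equal offsets would give [L * u = R * v] with [0 < u] and both factors at most [#|T|]. *)
have lem : m (N0 + i) <= m (N0 + j) by apply: leq_div2r; rewrite leq_mul2r; lia.
have E : L * (j - i) = R * (m (N0 + j) - m (N0 + i)).
  rewrite !mulnBr; have := mo (N0 + i); have := mo (N0 + j).
  by rewrite eo !mulnDl; lia.
case: (incomm (j - i) (m (N0 + j) - m (N0 + i))) => //; try lia.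
apply: (@leq_trans (j - i)); last by lia.
by rewrite -(leq_pmul2l R0) -E leq_mul2r leLR orbT.
Qed.

(** Steps of [q] reduce any position to one below [q], whose shift by [p] still lies in the first
    [N] places. *)
Lemma period_extend (Omega : Type) (g : nat -> Omega) p q N N' :
  0 < q -> p + q <= N ->
  (forall j, j + p < N -> g (j + p) = g j) ->
  (forall j, j + q < N' -> g (j + q) = g j) ->
  forall j, j + p < N' -> g (j + p) = g j.
Proof.
move=> q0 le hp hq.
have hq' t j : j + t * q < N' -> g (j + t * q) = g j.
  elim: t j => [|t IH] j lt; first by rewrite addn0.
  rewrite mulSn [q + _]addnC addnA hq; last by lia.
  by apply: IH; lia.
move=> j lt; have ej := divn_eq j q; have ltm := ltn_pmod j q0.
have -> : j + p = j %% q + p + j %/ q * q by lia.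
rewrite {3}ej [_ + j %% q]addnC !hq'; try lia.
by apply: hp; lia.
Qed.

(* The factor [k.+1] makes periods at the levels [a] and [a.+1] add up to at most
   [k ^ a], so that the first one remains a period at the next level. *)
Lemma block_period_all (Q : finType) (Omega : Type) k (f : nat -> Omega)
    (tau : nat -> Q) s a0 :
  1 < k -> labelling k f tau -> tau (k * s) = tau s ->
  (forall a, a0 <= a ->
    exists p, [/\ 0 < p, k.+1 * p <= k ^ a & block_period k f s a p]) ->
  exists2 p, 0 < p & forall a, block_period k f s a p.
Proof.
move=> k1 lab fix0 short.
(* Since the digit [0] keeps the label of [s], each block of [s] is a prefix of the next. *)
have pre a t : t < k ^ a -> f (k ^ a.+1 * s + t) = f (k ^ a * s + t).
  move=> lt; rewrite expnSr -mulnA; exact: (labelling_block lab lt fix0).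
have pre' a e t : t < k ^ a -> f (k ^ (a + e) * s + t) = f (k ^ a * s + t).
  move=> lt; elim: e => [|e IH]; first by rewrite addn0.
  by rewrite addnS pre // (leq_trans lt) // leq_exp2l // leq_addr.
have [p [p0 lep perp]] := short a0 (leqnn _).
have main e : block_period k f s (a0 + e) p.
  elim: e => [|e IH]; first by rewrite addn0.
  have [q [q0 leq perq]] := short (a0 + e.+1) (leq_addr _ _).
  apply: (@period_extend _ (fun j => f (k ^ (a0 + e.+1) * s + j)) p q (k ^ (a0 + e))) => //.
    have le1 : k ^ a0 <= k ^ (a0 + e) by rewrite leq_exp2l // leq_addr.
    have k0 : 0 < k.+1 by [].
    rewrite -(leq_pmul2l k0) mulnDr mulSn; move: leq; rewrite addnS expnS; lia.
  move=> j lt; rewrite addnS !pre //; last by lia.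
  exact: IH.
exists p => // a; case: (leqP a0 a) => [le|lt]; first by rewrite -(subnKC le).
move=> j ltj; have := main 0 j; rewrite addn0 -(subnKC (ltnW lt)) !pre'; try lia.
apply; apply: leq_trans ltj _; rewrite leq_exp2l //; lia.
Qed.

Lemma block_period_mul (Omega : Type) k (f : nat -> Omega) s a p t :
  block_period k f s a p -> block_period k f s a (t * p).
Proof.
move=> per; elim: t => [|t IH] j; first by rewrite addn0.
rewrite mulSn [p + _]addnC addnA => lt; rewrite per //.
by apply: IH; lia.
Qed.

Lemma block_period_desc (Omega : Type) k (f : nat -> Omega) s p a r :
  r < k ^ a -> (forall a', block_period k f s a' p) ->
  forall a', block_period k f (k ^ a * s + r) a' p.
Proof.
move=> lt per a' j ltj.
have E x : k ^ a' * (k ^ a * s + r) + x = k ^ (a' + a) * s + (k ^ a' * r + x).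
  by rewrite expnD; lia.
rewrite !E [_ + (j + p)]addnA; apply: per; rewrite -addnA.
apply: (@leq_trans (k ^ a' * r.+1)); first by rewrite mulnS; lia.
by rewrite expnD leq_mul2l lt orbT.
Qed.

Lemma block_period_label (Q : finType) (Omega : Type) k (f : nat -> Omega)
    (tau : nat -> Q) n n' p :
  labelling k f tau -> tau n = tau n' ->
  (forall a, block_period k f n a p) -> forall a, block_period k f n' a p.
Proof.
move=> lab e per a j lt; rewrite -!(labelling_block lab _ e) //; last by lia.
exact: per.
Qed.

(** Each of the finitely many labels below [s] has its own return path; as the digit [0] keeps the
    label of [s], trailing zeros give all paths a common length. *)
Lemma uniform_return (Q : finType) (Omega : Type) k (f : nat -> Omega)
    (tau : nat -> Q) s :
  1 < k -> labelling k f tau -> tau (k * s) = tau s ->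
  (forall a r, r < k ^ a -> exists a' r', r' < k ^ a' /\
    tau (k ^ a' * (k ^ a * s + r) + r') = tau s) ->
  exists D, forall a r, r < k ^ a -> exists2 r', r' < k ^ D &
    tau (k ^ D * (k ^ a * s + r) + r') = tau s.
Proof.
move=> k1 lab fix0 ret.
have [|D HD] := @uniform_bound Q (fun q D => forall a r, r < k ^ a ->
    tau (k ^ a * s + r) = q -> exists2 r', r' < k ^ D &
    tau (k ^ D * (k ^ a * s + r) + r') = tau s); last first.
  by exists D => a r lt; apply: (HD (tau (k ^ a * s + r)) a r lt).
move=> q; have [[a [r [lt e]]]|nex] := classic (exists a r, r < k ^ a /\ tau (k ^ a * s + r) = q);
  last by exists 0 => D _ a r lt e; case: nex; exists a, r.
have [a' [r' [lt' e']]] := ret a r lt.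
have pad m c : tau m = tau s -> tau (k ^ c * m) = tau s.
  move=> em; elim: c => [|c IH]; first by rewrite mul1n.
  rewrite expnS -mulnA -fix0 -[k * _]addn0 -[k * s]addn0.
  by apply: lab.1 => //; lia.
exists a' => D leD a1 r1 lt1 e1.
exists (k ^ (D - a') * r').
  by rewrite -{2}(subnK leD) expnD ltn_pmul2l // expn_gt0; lia.
have -> : k ^ D * (k ^ a1 * s + r1) + k ^ (D - a') * r'
    = k ^ (D - a') * (k ^ a' * (k ^ a1 * s + r1) + r').
  by rewrite -{1}(subnK leD) expnD; lia.
apply: pad; rewrite -e'; apply: (labelling_desc lab) => //.
by rewrite e1 e.
Qed.

(** Starting below [k * n + 1] makes the offset positive; a final factor [k] makes the label fixed
    by the digit [0], by idempotence. *)
Lemma periodic_descendant (Q S : finType) (Omega : Type) k l (f : nat -> Omega)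
    (tau : nat -> Q) (sigma : nat -> S) n :
  1 < k -> 1 < l -> powers_disjoint k l -> labelling k f tau ->
  (forall n, tau (k * (k * n)) = tau (k * n)) ->
  asym_label l f sigma ->
  exists a r p, [/\ 0 < r, r < k ^ a, 0 < p &
    forall a', block_period k f (k ^ a * n + r) a' p].
Proof.
move=> k1 l1 disj lab idem asym.
have [a [r [lt rec]]] := recurrent_descendant tau (k * n + 1) k1.
set m := k ^ a * (k * n + 1) + r in rec.
have K0 : 0 < k ^ a by rewrite expn_gt0; lia.
have [D HD] : exists D, forall a r, r < k ^ a -> exists2 r', r' < k ^ D &
    tau (k ^ D * (k ^ a * (k * m) + r) + r') = tau (k * m).
  apply: (uniform_return k1 lab (idem m)) => a1 r1 lt1.
  have [|a2 [r2 [lt2 e2]]] := rec a1.+1 r1.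
    by apply: leq_trans lt1 _; rewrite leq_exp2l.
  exists a2.+1, (k * r2); split; first by rewrite expnS ltn_pmul2l //; lia.
  have -> : k ^ a2.+1 * (k ^ a1 * (k * m) + r1) + k * r2
     = k * (k ^ a2 * (k ^ a1.+1 * m + r1) + r2) + 0 by rewrite !expnS; lia.
  by rewrite -[k * m]addn0; apply: lab.1 => //; lia.
have [a0 short] := short_block_period k.+1 k1 l1 disj lab asym HD.
have [p p0 per] := block_period_all k1 lab (idem m) short.
exists a.+2, (k * (k ^ a + r)), p; split => //.
- by rewrite muln_gt0 addn_gt0 K0; lia.
- rewrite !expnS ltn_pmul2l; last by lia.
  apply: (@leq_trans (2 * k ^ a)); first by lia.
  by rewrite leq_mul2r k1 orbT.
have -> // : k ^ a.+2 * n + k * (k ^ a + r) = k * m.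
by rewrite /m !expnS; lia.
Qed.

(** Every label has a descendant with a period. Take for [p] the product of these periods, for [D]
    the largest depth, and for [good] the positive integers whose label forces the period [p]. *)
Lemma common_block_period (Q S : finType) (Omega : Type) k l (f : nat -> Omega)
    (tau : nat -> Q) (sigma : nat -> S) :
  1 < k -> 1 < l -> powers_disjoint k l -> labelling k f tau ->
  (forall n, tau (k * (k * n)) = tau (k * n)) ->
  asym_label l f sigma ->
  exists p (good : nat -> bool) D, [/\ 0 < p,
    forall n, good n -> 0 < n /\ forall a, block_period k f n a p,
    forall n a r, r < k ^ a -> good n -> good (k ^ a * n + r) &
    forall n, exists2 r, r < k ^ D & good (k ^ D * n + r)].
Proof.
move=> k1 l1 disj lab idem asym.
have [w Hw] : exists w : Q -> nat * nat * nat, forall q, let: (a, r, p) := w q in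
   [/\ 0 < r, r < k ^ a, 0 < p &
    forall n, tau n = q -> forall a', block_period k f (k ^ a * n + r) a' p].
  apply: (@fin_all_exists _ (fun=> nat * nat * nat)%type
   (fun q w => let: (a, r, p) := w in [/\ 0 < r, r < k ^ a, 0 < p &
    forall n, tau n = q -> forall a', block_period k f (k ^ a * n + r) a' p])) => q.
  have [[n Hn]|nex] := classic (exists n, tau n = q); last first.
    (* A label that never occurs gets a dummy triple meeting the three inequalities. *)
    exists (1, 1, 1); rewrite expn1; split => // n Hn; case: nex; by exists n.
  have [a [r [p [r0 lt p0 per]]]] := periodic_descendant n k1 l1 disj lab idem asym.
  exists (a, r, p); split => // n' Hn'.
  apply: (block_period_label lab) per; apply: (labelling_desc lab) => //.
  by rewrite Hn Hn'.
pose p := \prod_q (w q).2; pose D := \max_q (w q).1.1.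
have [G HG] : exists G : Q -> bool, forall q, G q <->
    forall n, tau n = q -> forall a, block_period k f n a p.
  apply: (@fin_all_exists _ (fun=> bool) (fun q b => b <->
    forall n, tau n = q -> forall a, block_period k f n a p)) => q.
  by have [H|H] := classic (forall n, tau n = q -> forall a, block_period k f n a p);
    [exists true | exists false].
exists p, (fun n => (0 < n) && G (tau n)), D; split.
- by rewrite prodn_gt0 // => q; have := Hw q; case: (w q) => [[a r] p'] [].
- by move=> n /andP[n0 /HG H]; split=> // a; apply: H.
- move=> n a r lt /andP[n0 /HG H]; apply/andP; split.
    by rewrite addn_gt0 muln_gt0 n0 expn_gt0; lia.
  apply/HG => n' Hn'; apply: (block_period_label lab (esym Hn')).
  by apply: block_period_desc => // a'; apply: H.
move=> n; have := Hw (tau n); have : (w (tau n)).1.1 <= D by apply: (leq_bigmax (tau n)).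
have : p = (\prod_(q | q != tau n) (w q).2) * (w (tau n)).2.
  by rewrite /p (bigD1 (tau n)) //= mulnC.
case: (w (tau n)) => [[a r] p'] /= ep leD [r0 lt p0 per].
have K0 : 0 < k ^ (D - a) by rewrite expn_gt0; lia.
exists (k ^ (D - a) * r); first by rewrite -{2}(subnK leD) expnD ltn_pmul2l.
apply/andP; split; first by rewrite addn_gt0 !muln_gt0 K0 r0 orbT.
have -> : k ^ D * n + k ^ (D - a) * r = k ^ (D - a) * (k ^ a * n + r) + 0.
  by rewrite -{1}(subnK leD) expnD; lia.
apply/HG => n' Hn'; apply: (block_period_label lab (esym Hn')).
apply: block_period_desc => // a'; rewrite ep; apply: block_period_mul.
exact: per.
Qed.

(** * Slow variation and dilations *)

Lemma count_below_lt (A : nat -> bool) n r :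
  r < n -> ~~ A r -> count_below A n <= n.-1.
Proof.
move=> lt nA; rewrite -(subnKC lt) count_belowD count_belowS (negbTE nA) addn0.
have := count_below_le A r; have := count_below_le (fun i => A (r.+1 + i)) (n - r.+1); lia.
Qed.

(** For [x > 0] this is Bernoulli's inequality [(1 + 1 / x) ^ j >= 1 + j / x], cleared of
    denominators. *)
Lemma exp_succ_dominates c x : exists j, c * x ^ j <= x.+1 ^ j.
Proof.
case: x => [|x]; first by exists 1; rewrite muln0.
have bern j : (x.+1 + j) * x.+1 ^ j <= x.+1 * x.+2 ^ j.
  elim: j => [|j IH]; first by rewrite addn0 !muln1.
  rewrite !expnS mulnCA [x.+1 * (x.+2 * _)]mulnCA.
  apply: (@leq_trans (x.+2 * ((x.+1 + j) * x.+1 ^ j))); last by rewrite leq_mul2l IH orbT.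
  by rewrite !mulnA leq_mul2r; apply/orP; right; nia.
exists (c * x.+1); rewrite -(@leq_pmul2l x.+1) //.
apply: leq_trans (bern _); rewrite mulnA leq_mul2r; apply/orP; right; lia.
Qed.

(** A bad integer has at most [K.-1] bad children and a good one none, so [j] levels reduce the bad
    proportion to at most [((K - 1) / K) ^ j]. *)
Lemma almost_all_hereditary (good : nat -> bool) K :
  (forall n r, r < K -> good n -> good (K * n + r)) ->
  (forall n, exists2 r, r < K & good (K * n + r)) ->
  almost_all good.
Proof.
move=> here ex; pose bad n := ~~ good n.
have K0 : 0 < K by have [r] := ex 0; lia.
have step T : count_below bad (K * T) <= K.-1 * count_below bad T.
  elim: T => [|T IH]; first by rewrite muln0.
  rewrite mulnSr count_belowD count_belowS mulnDr leq_add //.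
  rewrite /bad; case gT: (good T) => /=.
    by rewrite count_below0 // => i lt; rewrite negbK here.
  have [r lt gr] := ex T; rewrite muln1.
  by apply: (count_below_lt lt); rewrite negbK.
have iter j T : count_below bad (K ^ j * T) <= K.-1 ^ j * T.
  elim: j => [|j IH]; first by rewrite !mul1n count_below_le.
  rewrite !expnS -!mulnA; apply: leq_trans (step _) _.
  by rewrite leq_mul2l IH orbT.
exists bad => [c|n]; last by rewrite negbK.
(* The factor [2] pays for rounding [N] up to a multiple of [K ^ j]. *)
have [j] := exp_succ_dominates (2 * c) K.-1; rewrite prednK // => Hj.
exists (K ^ j) => N leN.
have Kj0 : 0 < K ^ j by rewrite expn_gt0 K0.
have le1 : count_below bad N <= K.-1 ^ j * (N %/ K ^ j).+1.
  apply: leq_trans (iter _ _); apply: count_below_mono.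
  by rewrite mulnC ltnW // ltn_ceil.
have le2 : 2 * c * count_below bad N <= K ^ j * (N %/ K ^ j).+1.
  apply: (@leq_trans (2 * c * (K.-1 ^ j * (N %/ K ^ j).+1))).
    by rewrite leq_mul2l le1 orbT.
  by rewrite mulnA leq_mul2r Hj orbT.
have := leq_trunc_div N (K ^ j); move: le2; rewrite mulnSr mulnC; lia.
Qed.

Lemma count_below_block_end K p T :
  p <= K -> count_below (fun x => K <= x %% K + p) (K * T) <= p * T.
Proof.
move=> le_pK; elim: T => [|T IH]; first by rewrite muln0.
rewrite !mulnSr count_belowD leq_add //.
rewrite -[X in count_below _ X](subnK le_pK) count_belowD count_below0; first exact: count_below_le.
move=> i lt; rewrite -ltnNge mulnC modnMDl modn_small; lia.
Qed.

(** The shift can change the value only if the block of [n] is not good or [n] is among the last [p]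
    places of its block, a proportion [p / K]. *)
Lemma almost_all_shift (Omega : finType) k (f : nat -> Omega) p (good : nat -> bool) :
  1 < k -> (forall n, good n -> forall a, block_period k f n a p) ->
  almost_all good -> almost_all (fun n => f (n + p) = f n).
Proof.
move=> k1 per aag; exists (fun n => f (n + p) != f n) => [c|n /negPn/eqP //].
(* [k ^ M > M] makes [K] exceed [p] and [4 * c * p]. *)
set M := 4 * c * p + p; set K := k ^ M.
have ltK : M < K by apply: ltn_expl.
have K0 : 0 < K by lia.
have [A A0 HA] := almost_all_floor 0 (ltn0Sn 0) K0 aag.
have [N1 H1] := A0 (2 * c).
exists (N1 + 4 * c * p) => N leN.
have {}H1 := H1 N (leq_trans (leq_addr _ _) leN).
pose B x := K <= x %% K + p.
have le1 : count_below (fun n => f (n + p) != f n) N <= count_below A N + count_below B N.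
  apply: leq_trans (count_belowU _ _ _); apply: count_below_sub => n _.
  apply: contraR; rewrite negb_or => /andP[/HA]; rewrite mul1n addn0 => gn.
  rewrite -ltnNge => lt; rewrite (divn_eq n K) [_ * K]mulnC -addnA.
  by apply/eqP; apply: (per _ gn M).
have le2 : count_below B N <= p * (N %/ K).+1.
  apply: leq_trans (count_below_mono B _) (count_below_block_end _ _); last by lia.
  by rewrite mulnC ltnW // ltn_ceil.
have le3 : 4 * c * p * (N %/ K) <= N.
  by apply: leq_trans (leq_trunc_div N K); rewrite mulnC leq_mul2l; apply/orP; right; lia.
have le4 : c * count_below B N <= c * (p * (N %/ K).+1) by rewrite leq_mul2l le2 orbT.
have le5 : c * count_below (fun n => f (n + p) != f n) N
    <= c * (count_below A N + count_below B N) by rewrite leq_mul2l le1 orbT.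
move: le3 le4 le5 H1; rewrite mulnS !mulnDr; lia.
Qed.

Lemma almost_all_slow (Omega : Type) (f : nat -> Omega) p i X T :
  0 < p -> 0 < X -> almost_all (fun n => f (n + p) = f n) ->
  almost_all (fun n => forall t, t < T -> f (p * (X * n + t) + i) = f (p * (X * n) + i)).
Proof.
move=> p0 X0 shift; apply: almost_all_lt => t _; elim: t => [|t IH].
  by apply: almost_allT => n; rewrite addn0.
have pX0 : 0 < p * X by rewrite muln_gt0 p0.
have := almost_all_and IH (almost_all_affine (p * t + i) pX0 shift).
apply: almost_all_impl => n [<- e].
have -> : p * (X * n + t.+1) + i = p * X * n + (p * t + i) + p by lia.
by rewrite e; congr f; lia.
Qed.

(* On each residue class modulo [p] the sequence varies slowly, so a coincidence
   between two elements of the kernel becomes an invariance under dilation. *)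
Lemma almost_all_dilation (Omega : finType) l (f : nat -> Omega) p i :
  1 < l -> 0 < p -> asym_automatic l f ->
  almost_all (fun n => f (n + p) = f n) ->
  exists2 c, 0 < c & almost_all (fun n => f (p * (l ^ c * n) + i) = f (p * n + i)).
Proof.
move=> l1 p0 asym shift.
have [b [b' [_ ltb rec]]] := asym_recurrence i l1 asym.
have lb0 e : 0 < l ^ e by rewrite expn_gt0; lia.
exists (b' - b); first by rewrite subn_gt0.
have H := almost_all_and (almost_all_affine 0 p0 rec)
  (almost_all_and (almost_all_slow i (l ^ b) p0 (lb0 b) shift)
    (almost_all_slow i (l ^ b') p0 (lb0 b') shift)).
(* For [m = l ^ b * n + r], slow variation drops the terms coming from [r], and the coincidence of
   the levels [b] and [b'] at [p * n] links the two sides. *)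
have := almost_all_floor 0 (ltn0Sn 0) (lb0 b) H.
apply: almost_all_impl => m; rewrite mul1n !addn0 => -[e1 [e2 e3]].
have ltm : m %% l ^ b < l ^ b by rewrite ltn_mod.
set n := m %/ l ^ b in e1 e2 e3.
have em : m = l ^ b * n + m %% l ^ b by rewrite mulnC -divn_eq.
have Eb : l ^ b' = l ^ (b' - b) * l ^ b by rewrite -expnD subnK // ltnW.
rewrite {2}em e2 // {1}em.
have -> : l ^ (b' - b) * (l ^ b * n + m %% l ^ b) = l ^ b' * n + l ^ (b' - b) * (m %% l ^ b).
  by rewrite Eb; lia.
rewrite e3; last by rewrite Eb ltn_pmul2l.
by rewrite ![p * (_ * n)]mulnCA e1.
Qed.

Lemma almost_all_dilation_iter (Omega : Type) (F : nat -> Omega) x j :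
  0 < x -> almost_all (fun n => F (x * n) = F n) ->
  almost_all (fun n => F (x ^ j * n) = F n).
Proof.
move=> x0 H; elim: j => [|j IH]; first by apply: almost_allT => n; rewrite mul1n.
have := almost_all_and H (almost_all_affine 0 x0 IH).
by apply: almost_all_impl => n [<-]; rewrite addn0 expnSr mulnA.
Qed.

(** * Density of the ratios of powers *)

(** Dirichlet's pigeonhole argument, with bins of width [B / J < y - x], yields a nonzero difference
    [d] shorter than the interval; its multiples then step into it. *)
Lemma dense_differences (A B x y : R) :
  (0 < A)%real -> (0 < B)%real -> (x < y)%real ->
  (forall i j, 0 < i -> (INR i * A)%real <> (INR j * B)%real) ->
  exists i j, (x < INR i * A - INR j * B < y)%real.
Proof.
move=> A0 B0 xy irr.
have [J [J0 HJ]] : exists J, 0 < J /\ (B < INR J * (y - x))%real.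
  have [J HJ] := INR_unbounded (B / (y - x)); exists J; split.
    have q0 : (0 < B / (y - x))%real by apply: Rdiv_lt_0_compat; lra.
    by apply/ltP; apply: INR_lt; apply: Rlt_trans HJ.
  have := Rmult_lt_compat_r (y - x) _ _ ltac:(lra) HJ.
  by have -> : (B / (y - x) * (y - x) = B)%real by field; lra.
have JR : (1 <= INR J)%real by apply: (le_INR 1); lia.
pose near i (t : 'I_J) := exists j,
  (INR t * B <= INR J * (INR i * A - INR j * B) < (INR t + 1) * B)%real.
have [i [i' [t [lti _ [j [lo hi]] [j' [lo' hi']]]]]] : exists i j t,
    [/\ i < j, j <= #|'I_J|, near i t & near j t].
  apply: pigeonhole => i.
  have [|N [le lt]] := nfloor_ex (INR J * (INR i * A) / B).
    apply: Rdiv_le_0_compat => //; apply: Rmult_le_pos; first exact: pos_INR.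
    by apply: Rmult_le_pos; [exact: pos_INR | lra].
  have ltJ : N %% J < J by rewrite ltn_mod.
  exists (Ordinal ltJ), (N %/ J) => /=.
  have : INR N = (INR (N %/ J) * INR J + INR (N %% J))%real.
    by rewrite -mult_INR -plus_INR multE plusE -divn_eq.
  have E : (INR J * (INR i * A) / B * B = INR J * (INR i * A))%real by field; lra.
  have := Rmult_le_compat_r B _ _ ltac:(lra) le.
  have := Rmult_lt_compat_r B _ _ B0 lt.
  by rewrite E => h1 h2 e; rewrite e in h1 h2; split; nra.
have ltiR : (INR i + 1 <= INR i')%real by rewrite -S_INR; apply: le_INR; lia.
(* This makes [j' - j] a genuine difference: with [j' < j] the two values would be at least [A + B]
   apart. *)
have lej : j <= j'.
  rewrite leqNgt; apply/negP => ltj.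
  have ltjR : (INR j' + 1 <= INR j)%real by rewrite -S_INR; apply: le_INR; lia.
  have hA : (A <= (INR i' - INR i) * A)%real by nra.
  have hB : (B <= (INR j - INR j') * B)%real by nra.
  have := Rmult_le_compat_l (INR J) _ _ ltac:(lra) (Rplus_le_compat _ _ _ _ hA hB).
  have : (A + B <= INR J * (A + B))%real by nra.
  by lra.
have di : INR (i' - i) = (INR i' - INR i)%real by rewrite -minusE minus_INR //; lia.
have dj : INR (j' - j) = (INR j' - INR j)%real by rewrite -minusE minus_INR //; lia.
pose d := (INR (i' - i) * A - INR (j' - j) * B)%real.
have d0 : d <> 0%real.
  by rewrite /d => e; apply: (irr (i' - i) (j' - j)); [rewrite subn_gt0 | lra].
have dJ : (- B < INR J * d < B)%real by rewrite /d di dj; split; nra.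
have dlt : (- (y - x) < d < y - x)%real by split; nra.
have comb n : (INR n * d = INR (n * (i' - i)) * A - INR (n * (j' - j)) * B)%real.
  by rewrite -!multE !mult_INR /d; ring.
(* A positive [d] climbs from some [- j0 * B] below [x], a negative [d] descends from some [i0 * A]
   above [y]. *)
have [dpos|dneg] : (0 < d \/ d < 0)%real by lra.
  have [j0 Hj0] := INR_unbounded (- x / B).
  have Hj0' : (- x < INR j0 * B)%real.
    have := Rmult_lt_compat_r B _ _ B0 Hj0.
    by have -> : (- x / B * B = - x)%real by field; lra.
  have [|n [le lt]] := nfloor_ex ((x + INR j0 * B) / d).
    by apply: Rdiv_le_0_compat => //; lra.
  exists (n.+1 * (i' - i)), (j0 + n.+1 * (j' - j)).
  rewrite -plusE plus_INR.
  have := comb n.+1; rewrite S_INR => e.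
  have E : ((x + INR j0 * B) / d * d = x + INR j0 * B)%real by field; lra.
  have := Rmult_le_compat_r d _ _ ltac:(lra) le.
  have := Rmult_lt_compat_r d _ _ dpos lt.
  by rewrite E => h1 h2; split; lra.
have [i0 Hi0] := INR_unbounded (y / A).
have Hi0' : (y < INR i0 * A)%real.
  have := Rmult_lt_compat_r A _ _ A0 Hi0.
  by have -> : (y / A * A = y)%real by field; lra.
have [|n [le lt]] := nfloor_ex ((INR i0 * A - y) / - d).
  by apply: Rdiv_le_0_compat; lra.
exists (i0 + n.+1 * (i' - i)), (n.+1 * (j' - j)).
rewrite -plusE plus_INR.
have := comb n.+1; rewrite S_INR => e.
have E : ((INR i0 * A - y) / - d * - d = INR i0 * A - y)%real by field; lra.
have := Rmult_le_compat_r (- d) _ _ ltac:(lra) le.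
have := Rmult_lt_compat_r (- d) _ _ ltac:(lra) lt.
by rewrite E => h1 h2; split; lra.
Qed.

(** The conclusion means that the intervals from [n0] to [n0.+1] and from [n1] to [n1.+1] overlap
    once dilated by [k ^ i] and [l ^ j]. In logarithms it puts [i * ln k - j * ln l] in a nonempty
    open interval. *)
Lemma power_ratio_dense k l n0 n1 :
  1 < k -> 1 < l -> powers_disjoint k l -> 0 < n0 -> 0 < n1 ->
  exists i j, n1 * l ^ j < n0.+1 * k ^ i /\ n0 * k ^ i < n1.+1 * l ^ j.
Proof.
move=> k1 l1 disj n00 n10.
have pos n : 0 < n -> (0 < INR n)%real by move=> n_gt0; apply: lt_0_INR; lia.
have lnM a b e : 0 < a -> 0 < b ->
    ln (INR (a * b ^ e)) = (ln (INR a) + INR e * ln (INR b))%real.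
  move=> a0 b0; rewrite -multE mult_INR INR_expn ln_mult ?ln_pow //; try exact: pos.
  by apply: pow_lt; apply: pos.
have lt_of_ln a b : 0 < a -> 0 < b -> (ln (INR a) < ln (INR b))%real -> a < b.
  by move=> a0 b0 /ln_lt_inv H; apply/ltP; apply: INR_lt; apply: H; apply: pos.
have incr a b : 0 < a -> a < b -> (ln (INR a) < ln (INR b))%real.
  by move=> a0 ab; apply: ln_increasing; [exact: pos | apply: lt_INR; lia].
have k0 : 0 < k by lia.
have l0 : 0 < l by lia.
have [||||i [j [lo hi]]] := @dense_differences (ln (INR k)) (ln (INR l))
   (ln (INR n1) - ln (INR n0.+1)) (ln (INR n1.+1) - ln (INR n0)).
- exact: ln_INR_gt0.
- exact: ln_INR_gt0.
- by have := incr n0 n0.+1 n00 (ltnSn _); have := incr n1 n1.+1 n10 (ltnSn _); lra.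
- move=> i j i0 e; apply: (disj i j i0); apply: INR_eq; apply: ln_inv.
  + by apply: pos; rewrite expn_gt0 k0.
  + by apply: pos; rewrite expn_gt0 l0.
  + by rewrite !INR_expn !ln_pow //; exact: pos.
exists i, j; split; apply: lt_of_ln; rewrite ?muln_gt0 ?expn_gt0 ?k0 ?l0 ?n00 ?n10 ?orbT //.
  by rewrite !lnM //; lra.
by rewrite !lnM //; lra.
Qed.

(** * Comparison of blocks and the global period *)

Lemma block_constant (Omega : Type) k (f : nat -> Omega) n p M x x' :
  0 < k -> (forall a, block_period k f n a p) ->
  x %/ k ^ M = n -> x' %/ k ^ M = n -> x = x' %[mod p] -> f x = f x'.
Proof.
move=> k0 per; wlog le : x x' / x <= x'.
  by move=> H; case: (leqP x x') => [/H //|/ltnW/H {}H e e' em]; apply/esym/H.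
move=> e e' /esym em.
have dv : p %| x' - x by rewrite -eqn_mod_dvd //; apply/eqP.
have K0 : 0 < k ^ M by rewrite expn_gt0 k0.
have ex := divn_eq x (k ^ M); have ex' := divn_eq x' (k ^ M).
rewrite e mulnC in ex; rewrite e' mulnC in ex'.
have lt' := ltn_pmod x' K0.
move: (x %% k ^ M) (x' %% k ^ M) ex ex' lt' => r r' ex ex' lt'.
have E : r' = r + (x' - x) %/ p * p.
  by rewrite divnK //; move: (k ^ M * n) ex ex' le; clear; lia.
by rewrite ex' E {1}ex; apply/esym; apply: (block_period_mul (per M)); rewrite -E.
Qed.

(** A dilation by [X / Y] that almost preserves [F] is chosen so that it maps part of the block of
    [n0] into that of [n1]; one typical [n] there links the two values. *)
Lemma block_values_agree (Omega : finType) k l (f : nat -> Omega) p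
    (good : nat -> bool) n0 n1 i :
  1 < k -> 1 < l -> powers_disjoint k l -> 0 < p -> i < p ->
  asym_automatic k f -> asym_automatic l f ->
  (forall n, good n -> 0 < n /\ forall a, block_period k f n a p) ->
  almost_all good -> good n0 -> good n1 ->
  exists M0, forall M, M0 <= M -> forall x y, x %/ k ^ M = n0 -> y %/ k ^ M = n1 ->
    x %% p = i -> y %% p = i -> f x = f y.
Proof.
move=> k1 l1 disj p0 ltip autk autl per aag g0 g1.
have [n00 per0] := per _ g0; have [n10 per1] := per _ g1.
have shift : almost_all (fun n => f (n + p) = f n).
  by apply: (almost_all_shift k1 _ aag) => n /per[].
pose F n := f (p * n + i).
have [c c0 dilk] : exists2 c, 0 < c & almost_all (fun n => F (k ^ c * n) = F n).
  exact: almost_all_dilation.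
have [c' c'0 dill] : exists2 c, 0 < c & almost_all (fun n => F (l ^ c * n) = F n).
  exact: almost_all_dilation.
have kc1 : 1 < k ^ c by rewrite -(expn0 k) ltn_exp2l.
have lc1 : 1 < l ^ c' by rewrite -(expn0 l) ltn_exp2l.
have disj' : powers_disjoint (k ^ c) (l ^ c').
  move=> u v u0; rewrite -[(l ^ c') ^ v]expnM; exact: (powers_disjoint_pow c0 disj).
have [u [v [lt1 lt2]]] := power_ratio_dense kc1 lc1 disj' n00 n10.
have {}dilk := almost_all_dilation_iter u (ltnW kc1) dilk.
have {}dill := almost_all_dilation_iter v (ltnW lc1) dill.
have X0 : 0 < (k ^ c) ^ u by rewrite expn_gt0 (ltnW kc1).
have Y0 : 0 < (l ^ c') ^ v by rewrite expn_gt0 (ltnW lc1).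
move: ((k ^ c) ^ u) ((l ^ c') ^ v) dilk dill lt1 lt2 X0 Y0 => X Y dilk dill lt1 lt2 X0 Y0.
have slow := almost_all_slow i Y p0 Y0 shift.
(* Multiply by [X], drop the remainder modulo [Y] by slow variation, then divide by [Y]. *)
have scale : almost_all (fun n => F n = F (X * n %/ Y)).
  have := almost_all_and dilk (almost_all_floor 0 X0 Y0 (almost_all_and dill slow)).
  apply: almost_all_impl => n; rewrite addn0 => -[<- [<- e]].
  by rewrite /F {1}(divn_eq (X * n) Y) [_ * Y]mulnC e // ltn_mod.
set lo := maxn (n0 * X) (n1 * Y); set hi := minn (n0.+1 * X) (n1.+1 * Y).
have lohi : lo < hi by rewrite /lo /hi; lia.
have u0 : 0 < p * X by rewrite muln_gt0 p0.
(* The margin covers the offset [i] and the rounding in [X * n %/ Y]. *)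
have [M0 HM0] := almost_all_meets (p * X + p * Y) k1 u0 lohi scale.
exists M0 => M /HM0[n [eF le_lo le_hi]] x y ex ey exi eyi.
set K := k ^ M in le_lo le_hi ex ey.
have K0 : 0 < K by rewrite expn_gt0; lia.
have lo0 : n0 * X * K <= lo * K by rewrite leq_mul2r leq_maxl orbT.
have lo1 : n1 * Y * K <= lo * K by rewrite leq_mul2r leq_maxr orbT.
have hi0 : hi * K <= n0.+1 * X * K by rewrite leq_mul2r geq_minl orbT.
have hi1 : hi * K <= n1.+1 * Y * K by rewrite leq_mul2r geq_minr orbT.
have block z m Z : 0 < Z -> m * Z * K <= Z * z -> Z * z < m.+1 * Z * K -> z %/ K = m.
  move=> Z0; rewrite [m * Z]mulnC [m.+1 * Z]mulnC -!mulnA leq_pmul2l // ltn_pmul2l //.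
  move=> le lt; apply/eqP; rewrite eqn_leq leq_divRL // le andbT.
  by rewrite -ltnS ltn_divLR.
have mod_i m : (p * m + i) %% p = i by rewrite mulnC modnMDl modn_small.
have EZ Z m : Z * (p * m + i) = p * (Z * m) + Z * i by rewrite mulnDr mulnCA.
have Zi Z : 0 < Z -> Z * i < p * Z by move=> Z0; rewrite [p * Z]mulnC ltn_pmul2l.
rewrite -mulnA in le_lo; rewrite -mulnA in le_hi.
transitivity (F n).
  apply: (@block_constant _ k f n0 p M) => //; rewrite ?mod_i //; first by lia.
  apply: (block _ _ X) => //; rewrite EZ.
    by apply: leq_trans lo0 _; apply: leq_trans (leq_addr _ _) (leq_trans le_lo (leq_addr _ _)).
  apply: leq_trans hi0; apply: leq_trans le_hi; rewrite -addnS leq_add2l.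
  exact: leq_trans (Zi X X0) (leq_addr _ _).
rewrite eF; apply: (@block_constant _ k f n1 p M) => //; rewrite ?mod_i //; first by lia.
have er := divn_eq (X * n) Y; have ltr := ltn_pmod (X * n) Y0.
set q := X * n %/ Y in er *.
have pr : p * (X * n %% Y) < p * Y by rewrite ltn_pmul2l.
have pe : p * (X * n) = p * (Y * q) + p * (X * n %% Y).
  by rewrite {1}er mulnDr [q * Y]mulnC.
have Yi := Zi Y Y0.
rewrite pe in le_lo le_hi; apply: (block _ _ Y) => //; rewrite EZ.
  apply: leq_trans lo1 _; move: le_lo pr; clear; move: (lo * K) (p * (Y * q)) => u v; lia.
apply: leq_trans hi1; apply: leq_trans le_hi; move: Yi; clear; lia.
Qed.

Lemma residue_above p N i : i < p -> exists x, [/\ N <= x, x < N + p & x %% p = i].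
Proof.
move=> lti; have p0 : 0 < p by lia.
have eN := divn_eq N p; have ltN := ltn_pmod N p0.
have [le|lt] := leqP (N %% p) i.
  by exists (N %/ p * p + i); rewrite modnMDl modn_small //; split => //; lia.
by exists ((N %/ p).+1 * p + i); rewrite modnMDl modn_small // mulSn; split => //; lia.
Qed.

(** The block of [k * z] at level [M] lies inside that of [z] at level [M.+1] and, for large [M],
    agrees with that of [z] at level [M]; so the value on [z] stabilises, and every good [n] is
    compared with [z]. *)
Lemma eventual_block_value (Omega : finType) k l (f : nat -> Omega) p
    (good : nat -> bool) z i :
  1 < k -> 1 < l -> powers_disjoint k l -> 0 < p -> i < p ->
  asym_automatic k f -> asym_automatic l f ->
  (forall n, good n -> 0 < n /\ forall a, block_period k f n a p) ->
  almost_all good -> good z -> good (k * z) ->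
  exists w, forall n, good n -> exists M0, forall M, M0 <= M ->
    forall x, x %/ k ^ M = n -> x %% p = i -> f x = w.
Proof.
move=> k1 l1 disj p0 lti autk autl per aag gz gkz.
have [_ perz] := per z gz.
have K0 M : 0 < k ^ M by rewrite expn_gt0; lia.
have in_block M m : p <= M -> exists2 x, x %/ k ^ M = m & x %% p = i.
  move=> lep; have {}lep : p <= k ^ M by apply: leq_trans lep (ltnW (ltn_expl _ k1)).
  have [x [le lt ex]] := residue_above (m * k ^ M) lti.
  exists x => //; apply/eqP.
  by rewrite eqn_leq leq_divRL // le andbT -ltnS ltn_divLR // mulSn; lia.
have agree n : good n -> _ :=
  fun gn => block_values_agree k1 l1 disj p0 lti autk autl per aag gz gn.
have [M1 HM1] := agree _ gkz.
have [x0 ex0 ix0] := in_block (M1 + p) z (leq_addl _ _).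
have lep e : p <= M1 + p + e by lia.
have leM1 e : M1 <= M1 + p + e by lia.
have k0 : 0 < k by exact: ltnW.
have val e x : x %/ k ^ (M1 + p + e) = z -> x %% p = i -> f x = f x0.
  elim: e x => [|e IH] x ex ix.
    rewrite addn0 in ex.
    by apply: (block_constant k0 perz ex ex0); rewrite ix ix0.
  have [y ey iy] := in_block (M1 + p + e) z (lep e).
  have [t et it] := in_block (M1 + p + e) (k * z) (lep e).
  have et' : t %/ k ^ (M1 + p + e.+1) = z.
    by rewrite addnS expnSr divnMA et mulKn.
  rewrite -(IH y ey iy) (HM1 (M1 + p + e) (leM1 e) y t ey et iy it).
  by apply: (block_constant k0 perz ex et'); rewrite ix it.
exists (f x0) => n /agree[M2 HM2]; exists (M1 + p + M2) => M leM x ex ix.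
have leM' : M1 + p <= M by apply: leq_trans leM; apply: leq_addr.
have [y ey iy] := in_block M z (leq_trans (leq_addl _ _) leM').
rewrite -(HM2 M (leq_trans (leq_addl _ _) leM) y x ey ex iy ix).
by apply: (val (M - (M1 + p)) y); rewrite ?subnKC.
Qed.

(** The threshold on [M] depends on the block, so [N] is read at a scale [k ^ M] where boundedly
    many leading parts [x %/ k ^ M] occur, most of them good. *)
Lemma asym_periodic (Omega : finType) k (f : nat -> Omega) p (good : nat -> bool)
    (w : 'I_p -> Omega) :
  1 < k -> 0 < p -> almost_all good ->
  (forall (i : 'I_p) n, good n -> exists M0, forall M, M0 <= M ->
    forall x, x %/ k ^ M = n -> x %% p = i -> f x = w i) ->
  exists g : nat -> Omega, periodic g /\ asym_eq f g.
Proof.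
move=> k1 p0 [A A0 HA] Hw.
pose g n := w (Ordinal (ltn_pmod n p0)).
exists g; split.
  by exists p; split => // n; congr w; apply: val_inj; rewrite /= modnDr.
apply/asym_eq_almost_all; exists (fun n => f n != g n) => [c|n /negPn/eqP //].
have [T0 HT0] := A0 (2 * c).
pose T := k * T0.+1.
have [|M1 HM1] := @uniform_bound ('I_T.+1 * 'I_p)%type (fun q M1 =>
    good q.1 -> forall M, M1 <= M -> forall x, x %/ k ^ M = q.1 -> x %% p = q.2 -> f x = w q.2).
  move=> [n i] /=; case gn: (good n); last by exists 0.
  have [M0 HM0] := Hw i n gn; exists M0 => D leD _ M leM.
  by apply: HM0; apply: leq_trans leM.
exists (T0.+1 * k ^ M1) => N leN.
(* The leading part of [N] exceeds [T0], where exceptions are already sparse, and stays below [T],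
   where the threshold [M1] is valid. *)
have [M [leM lo hi]] : exists M, [/\ M1 <= M, T0.+1 * k ^ M <= N & N < T0.+1 * k ^ M.+1].
  have ex : exists M, N < T0.+1 * k ^ M.+1.
    exists N; apply: leq_trans (ltn_expl N k1) _.
    by rewrite expnSr mulnCA leq_pmulr // muln_gt0; lia.
  case: (ex_minnP ex) => M ltM minM.
  have leM : M1 <= M.
    rewrite leqNgt; apply/negP => lt; have : k ^ M.+1 <= k ^ M1 by rewrite leq_exp2l.
    by rewrite -(@leq_pmul2l T0.+1) //; lia.
  exists M; split => //; case: (M) leM minM => [|M'] leM minM.
    by apply: leq_trans leN; rewrite leq_mul2l leq_exp2l // leq0n orbT.
  by rewrite leqNgt; apply/negP => /minM; rewrite ltnn.
have K0 : 0 < k ^ M by rewrite expn_gt0; lia.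
set q := N %/ k ^ M.
have leq : q < T by rewrite /q ltn_divLR // /T -mulnA [k * _]mulnC -mulnA -expnSr.
have geq : T0 < q by rewrite /q leq_divRL.
have le1 : count_below (fun n => f n != g n) N <= k ^ M * count_below A q.+1.
  have fib x y : x %/ k ^ M = y %/ k ^ M -> y <= x + (k ^ M).-1.
    move=> e; have := divn_eq y (k ^ M); rewrite -e.
    by have := divn_eq x (k ^ M); have := ltn_pmod y K0; lia.
  have ltq x : x < N -> x %/ k ^ M < q.+1.
    by move=> lt; rewrite ltnS leq_div2r // ltnW.
  have := count_below_comp A ltq fib; rewrite prednK //; apply: leq_trans.
  apply: count_below_sub => x ltx; apply: contraR => /HA gx.
  have ltT : x %/ k ^ M < T.+1 by have := ltq x ltx; lia.
  by apply/eqP; exact: (HM1 (Ordinal ltT, Ordinal (ltn_pmod x p0)) gx M leM).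
have le2 : 2 * c * count_below A q.+1 <= q.+1 by apply: HT0; lia.
have le3 : c * count_below (fun n => f n != g n) N <= c * (k ^ M * count_below A q.+1).
  by rewrite leq_mul2l le1 orbT.
have le4 : k ^ M * (2 * c * count_below A q.+1) <= k ^ M * q.+1.
  by rewrite leq_mul2l le2 orbT.
have := leq_trunc_div N (k ^ M); rewrite -/q => le5.
have le6 : k ^ M <= q * k ^ M by rewrite leq_pmull //; lia.
rewrite mulnS in le4; lia.
Qed.

Theorem theoremB (Omega : finType) (k l : nat) (f : nat -> Omega) :
  2 <= k -> 2 <= l -> mult_indep k l ->
  automatic k f -> asym_automatic l f ->
  exists g : nat -> Omega, periodic g /\ asym_eq f g.
Proof.
move=> k1 l1 /(mult_indep_powers_disjoint k1 l1) disj autk autl.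
have [Q [tau lab]] := automatic_labelling autk.
have [S [sigma asym]] := asym_labelling autl.
have [h h0 idem] := labelling_idempotent k1 lab.
(* Replacing [k] by [k ^ h] makes multiplication by the base idempotent on labels. *)
have {}k1 : 1 < k ^ h by rewrite -(expn0 k) ltn_exp2l.
have {}disj := powers_disjoint_pow h0 disj.
have {}lab := labelling_pow h lab.
have {autk} autk : asym_automatic (k ^ h) f.
  apply: automatic_asym_automatic; have [s Hs] := autk; exists s => g [a [r [lt ->]]].
  by apply: Hs; exists (h * a), r; rewrite expnM.
move: (k ^ h) k1 disj lab idem autk => {}k {h h0} k1 disj lab idem autk.
have [p [good [D [p0 per here ex]]]] := common_block_period k1 l1 disj lab idem asym.
have aag : almost_all good.
  by apply: (@almost_all_hereditary _ (k ^ D)) => // n r; apply: here.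
(* A good descendant of [0] serves as the reference block. *)
have [r _ gz] := ex 0; set z := k ^ D * 0 + r in gz.
have gkz : good (k * z) by have := here z 1 0; rewrite expn1 addn0; apply => //; lia.
have [w Hw] : exists w : 'I_p -> Omega, forall (i : 'I_p) n, good n ->
    exists M0, forall M, M0 <= M -> forall x, x %/ k ^ M = n -> x %% p = i -> f x = w i.
  apply: (@fin_all_exists _ (fun=> Omega) (fun (i : 'I_p) w => forall n, good n ->
    exists M0, forall M, M0 <= M -> forall x, x %/ k ^ M = n -> x %% p = i -> f x = w)) => i.
  exact: (eventual_block_value k1 l1 disj p0 (ltn_ord i) autk autl per aag gz gkz).
exact: asym_periodic k1 p0 aag Hw.
Qed.
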